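(* Let $M\in N_4^+$ be given by $$M=J_1(x_{12})J_2(x_{13})J_1(x_{23})J_3(x_{14})J_2(x_{24})J_1(x_{34}),$$ considered as a matrix function in the variables $x_{12},x_{13},x_{23},x_{14},x_{24},x_{34}$ (positive). Then $$L_{123}(L_{124}(L_{134}(L_{234}(M))))=L_{234}(L_{134}(L_{124}(L_{123}(M))))=\bar M',$$ $$R_{123}(R_{124}(R_{134}(R_{234}(M))))=R_{234}(R_{134}(R_{124}(R_{123}(M))))=\bar M''.$$
   Context: Matrices: $B_n$ is the group of $n\times n$ real invertible upper triangular matrices and $N_n\subset B_n$ its unipotent subgroup (ones on the diagonal). $G\in B_n$ is totally positive if every minor of $G$ that does not vanish identically (as a function on $B_n$) is positive. $N_n^+\subset N_n$ is the subset of totally positive matrices. Jacobi coordinates: for $1\le k\le n-1$, $J_k(x)=\exp(xe_k)\in N_n$ with $(e_k)_{ij}=\delta_{ik}\delta_{j,k+1}$. It is known that every $M\in N_n^+$ has a unique representation $M=\mathbb J_1\cdots\mathbb J_{n-1}$, $\mathbb J_k=J_k(x_{1,k+1})J_{k-1}(x_{2,k+1})\cdots J_1(x_{k,k+1})$, with positive reals $x_{ij}=x_{ij}(M)$, $1\le i<j\le n$ (the Jacobi coordinates of $M$), and conversely every such product lies in $N_n^+$. Maps $M\mapsto M',M''$: let $P$ be the $n\times n$ matrix with $P_{ij}=\delta_{i+j,n+1}$. For every $M\in N_n^+$ there exist unique $M',M''\in N_n^+$ and a unique diagonal matrix $D_M$ such that $PMP=M'PD_MM''$. Map $M\mapsto\bar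 M$: $\bar M\in N_n^+$ is the matrix with $x_{ij}(\bar M)=1/x_{ij}(M)$ for all $i<j$. One has $(\bar M)'=\overline{(M')}$ and $(\bar M)''=\overline{(M'')}$, and these matrices are denoted $\bar M'$ and $\bar M''$. Changes of variables: for $1\le a<b<c\le n$, $L_{abc}$ and $R_{abc}$ are the substitutions (acting on functions of the $x_{ij}$, and entrywise on matrix functions) that affect only $x_{ab},x_{ac},x_{bc}$ and are given by $$L_{abc}(x_{ab})=x_{ac},\quad L_{abc}(x_{ac})=x_{ab},\quad L_{abc}(x_{bc})=\frac{x_{ac}x_{bc}}{x_{ab}},$$ $$R_{abc}(x_{ab})=\frac{x_{ab}x_{ac}}{x_{bc}},\quad R_{abc}(x_{ac})=x_{bc},\quad R_{abc}(x_{bc})=x_{ac}.$$ *)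

(* Defs.v *)
From mathcomp Require Import all_boot all_order all_algebra.
From mathcomp Require Import all_classical all_reals all_analysis.
Set Implicit Arguments.
Unset Strict Implicit.
Unset Printing Implicit Defensive.
Import Order.TTheory GRing.Theory Num.Theory.
Import numFieldNormedType.Exports.
Local Open Scope classical_set_scope.
Local Open Scope ring_scope.

Section Matrices.
Variables (R : realType) (n : nat).

(* [upper_inv], [unip] and [unip_tp] are membership in the groups B_n, N_n and in
   the set N_n^+ of totally positive elements of N_n. *)
Definition upper_inv (G : 'M[R]_n) : Prop :=
  (forall i j : 'I_n, (j < i)%N -> G i j = 0) /\ G \in unitmx.

Definition unip (G : 'M[R]_n) : Prop :=
  upper_inv G /\ (forall i : 'I_n, G i i = 1).

(* The minor of [G] with row set [f 0 < f 1 < ...] and column set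
   [g 0 < g 1 < ...]; only used with increasing [f] and [g]. *)
Definition minor k (f g : 'I_k -> 'I_n) (G : 'M[R]_n) : R :=
  \det (mxsub f g G).

Definition increasing k (f : 'I_k -> 'I_n) : Prop :=
  forall i j : 'I_k, (i < j)%N -> (f i < f j)%N.

Definition totally_positive (G : 'M[R]_n) : Prop :=
  forall k (f g : 'I_k -> 'I_n), increasing f -> increasing g ->
  (exists2 H : 'M[R]_n, upper_inv H & minor f g H != 0) -> 0 < minor f g G.

Definition unip_tp (G : 'M[R]_n) : Prop := unip G /\ totally_positive G.

(* Powers are written as iterated products because ['M[R]_n] is a (non-trivial)
   ring only for [n] of the form [_.+1]. *)
Definition expmx (A : 'M[R]_n) : 'M[R]_n :=
  limn (series (fun k => (k`!%:R)^-1 *: iter k (mulmx A) 1%:M)).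

(* In what follows row, column and coordinate indices are natural numbers
   counted from 1; an index [i : 'I_n] stands for [i.+1]. *)

Definition e_mx (k : nat) : 'M[R]_n :=
  \matrix_(i, j) ((i.+1 == k) && (j.+1 == k.+1))%:R.

Definition Jmx (k : nat) (x : R) : 'M[R]_n := expmx (x *: e_mx k).

(* The values [x i j] matter only for [1 <= i < j <= n]. *)
Definition coords := nat -> nat -> R.

Definition pos_coords (x : coords) : Prop :=
  forall i j, (1 <= i)%N -> (i < j)%N -> (j <= n)%N -> 0 < x i j.

(* [Jacobi_block x k] is
   J_k(x_{1,k+1}) J_{k-1}(x_{2,k+1}) ... J_1(x_{k,k+1}). *)
Definition Jacobi_block (x : coords) (k : nat) : 'M[R]_n :=
  \big[mulmx/1%:M]_(1 <= i < k.+1) Jmx (k.+1 - i) (x i k.+1).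

Definition Jacobi_prod (x : coords) : 'M[R]_n :=
  \big[mulmx/1%:M]_(1 <= k < n) Jacobi_block x k.

(* The coordinates are unique, for [M] unipotent totally positive, only for
   [1 <= i < j <= n]; the other values of [Jacobi_coords M] are unspecified,
   and [Jacobi_prod] ignores them. *)
Definition Jacobi_coords (M : 'M[R]_n) : coords :=
  xget (fun _ _ => 0) [set x | pos_coords x /\ M = Jacobi_prod x].

Definition bar (M : 'M[R]_n) : 'M[R]_n :=
  Jacobi_prod (fun i j => (Jacobi_coords M i j)^-1).

Definition revmx : 'M[R]_n := \matrix_(i, j) ((i.+1 + j.+1)%N == n.+1)%:R.

Definition twist_rel (M : 'M[R]_n) (T : 'M[R]_n * 'M[R]_n * 'M[R]_n) : Prop :=
  let: (M1, D, M2) := T in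
  [/\ unip_tp M1, unip_tp M2, is_diag_mx D &
      revmx *m M *m revmx = M1 *m revmx *m D *m M2].

(* The triple (M', D_M, M''), with a junk value when no such triple exists. *)
Definition twist_triple (M : 'M[R]_n) : 'M[R]_n * 'M[R]_n * 'M[R]_n :=
  xget (0, 0, 0) [set T | twist_rel M T].

(* The maps M |-> M' and M |-> M''. *)
Definition mprime (M : 'M[R]_n) : 'M[R]_n := (twist_triple M).1.1.
Definition msecond (M : 'M[R]_n) : 'M[R]_n := (twist_triple M).2.

End Matrices.

Section Substitutions.
Variables (R : realType) (T : Type).

Definition upd3 (a b c : nat) (vab vac vbc : R) (x : coords R) : coords R :=
  fun i j =>
    if (i == a) && (j == b) then vab
    else if (i == a) && (j == c) then vac
    else if (i == b) && (j == c) then vbc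
    else x i j.

(* A substitution acts on a function of the coordinates by precomposition; with
   [T] a matrix type this is its entrywise action on matrix functions. *)
Definition Lsub (a b c : nat) (F : coords R -> T) : coords R -> T :=
  fun x => F (upd3 a b c (x a c) (x a b) (x a c * x b c / x a b) x).

Definition Rsub (a b c : nat) (F : coords R -> T) : coords R -> T :=
  fun x => F (upd3 a b c (x a b * x a c / x b c) (x b c) (x a c) x).

End Substitutions.

(* Main.v *)
Require Import Defs.
From mathcomp Require Import all_boot all_order all_algebra.
From mathcomp Require Import all_classical all_reals all_analysis.
From mathcomp Require Import perm ring lra zify.
Set Implicit Arguments.
Unset Strict Implicit.
Unset Printing Implicit Defensive.
Import Order.TTheory GRing.Theory Num.Theory.
Local Open Scope ring_scope.

(** Since [e_k] squares to zero, [J_k(x) = 1 + x e_k], so everything happens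
    among explicit 4x4 upper unitriangular matrices.  Writing [M x] with
    [a, ..., f] for x_12, x_13, x_23, x_14, x_24, x_34, the two orders of
    substitution give the same coordinates
      L : d, b, de/b, a, bc/a, def/(bc),
      R : abd/(ce), ce/f, bd/e, f, e, d,
    and with D = diag(1/(abd), -a/(ce), bc/f, -def) these matrices satisfy
    P bar(M) P = M' P D M''.  Uniqueness of (M', M'') is uniqueness of the LDU
    factorization of bar(M) P = (P M' P) D M''; total positivity of M' and M''
    follows from subtraction-free formulas for their minors. *)

(** * The exponentials $J_k(x)$ *)

(** All terms of degree at least 2 vanish, so the partial sums are constant from index 2 on and the
    limit is this constant. *)
Lemma expmx_sqr0 (R : realType) n (A : 'M[R]_n) :
  A *m A = 0 -> expmx A = 1%:M + A.
Proof.
move=> A2; apply: (@norm_lim_near_cst R 'M[R]_n).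
near=> m.
have m2 : (2 <= m)%N by near: m; exact: nbhs_infty_ge.
rewrite -(subnKC m2) /series /= addSn addSn add0n.
rewrite big_nat_recl// big_nat_recl//=.
rewrite !invr1 !scale1r mulmx1 big1 ?addr0// => i _.
by rewrite /= mulmxA A2 mul0mx scaler0.
Unshelve. all: by end_near.
Qed.

Lemma Jmx1 (R : realType) n k (x : R) : Jmx n k x = 1%:M + x *: e_mx R n k.
Proof.
rewrite /Jmx expmx_sqr0// -scalemxAl -scalemxAr.
suff -> : e_mx R n k *m e_mx R n k = 0 by rewrite !scaler0.
apply/matrixP => i j; rewrite !mxE big1// => l _; rewrite !mxE.
case: (l.+1 =P k.+1) => [->|_]; last by rewrite andbF mul0r.
by rewrite (gtn_eqF (ltnSn k)) mulr0.
Qed.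

(** * Uniqueness of the LDU factorization *)

Section LDU.
Variables (F : fieldType) (n : nat).

Definition lower_unitri (L : 'M[F]_n) :=
  (forall i j : 'I_n, (i < j)%N -> L i j = 0) /\ forall i, L i i = 1.

(** Strong induction on $m$: once the earlier pivots, columns of [L] and rows of [U] are known, row
    $m$ and column $m$ of the product determine the next ones, after division by the pivot
    [d 0 m]. *)
Lemma LDU_uniq (L L' U U' : 'M[F]_n) (d d' : 'rV[F]_n) :
  lower_unitri L -> lower_unitri L' -> lower_unitri U^T -> lower_unitri U'^T ->
  (forall i, d 0 i != 0) ->
  L *m diag_mx d *m U = L' *m diag_mx d' *m U' ->
  L = L' /\ U = U'.
Proof.
move=> [L0 L1] [L0' L1'] [U0 U1] [U0' U1'] dN0 eqM.
have UT (V : 'M[F]_n) i j : V i j = V^T j i by rewrite mxE.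
suff H (m : 'I_n) :
    d 0 m = d' 0 m /\ forall i, L i m = L' i m /\ U m i = U' m i.
  split; apply/matrixP => i j; first by case: (H j) => _ /(_ i) [].
  by case: (H i) => _ /(_ j) [].
have [k] := ubnP (m : nat); elim: k m => // k IHk m; rewrite ltnS => le_mk.
(* In entry (i, j) of both products the terms l < m agree by induction and the
   terms l > m vanish by triangularity. *)
have key i j : i = m \/ j = m ->
    L i m * d 0 m * U m j = L' i m * d' 0 m * U' m j.
  move=> ij; have /matrixP/(_ i j) := eqM; rewrite !mul_mx_diag !mxE.
  rewrite (bigD1 m)//= [in RHS](bigD1 m)//= !mxE.
  set s := \sum_(l < n | _) _; set s' := \sum_(l < n | _) _.
  suff -> : s = s' by move/addIr.
  apply: eq_bigr => l lm; rewrite !mxE.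
  have [lm'|] := ltnP l m.
    by have [-> H] := IHk l (leq_trans lm' le_mk); rewrite (H i).1 (H j).2.
  rewrite leq_eqVlt eq_sym val_eqE (negPf lm) => /= ml.
  case: ij => ->; first by rewrite L0// L0'// !mul0r.
  by rewrite (UT U) (UT U') U0// U0'// !mulr0.
have [Um Um'] : U m m = 1 /\ U' m m = 1 by rewrite (UT U) (UT U') U1 U1'.
have dm : d 0 m = d' 0 m.
  by have := key m m (or_introl erefl); rewrite L1 L1' Um Um' !mul1r !mulr1.
split=> // i; split.
  have := key i m (or_intror erefl); rewrite Um Um' !mulr1 dm.
  by move/mulIf; apply; rewrite -dm.
have := key m i (or_introl erefl); rewrite L1 L1' !mul1r dm.
by move/mulfI; apply; rewrite -dm.
Qed.

End LDU.

(** * Minors that do not vanish identically on $B_n$ *)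

Lemma increasing_le n k (f : 'I_k -> 'I_n) :
  increasing f -> forall i j : 'I_k, (i <= j)%N -> (f i <= f j)%N.
Proof.
move=> fI i j; rewrite leq_eqVlt => /orP[/eqP/val_inj->//|/fI]; exact: ltnW.
Qed.

(** Turns the nonvanishing condition of [totally_positive] into inequalities between indices. If
    [g m < f m], each term of the Leibniz expansion contains an entry below the diagonal. *)
Lemma minor_neq0_le (R : realType) n (H : 'M[R]_n) k (f g : 'I_k -> 'I_n) :
  upper_inv H -> increasing f -> increasing g -> minor f g H != 0 ->
  forall i, (f i <= g i)%N.
Proof.
move=> [H0 _] fI gI /eqP mN0 m; rewrite leqNgt; apply/negP => gf_m.
apply: mN0; rewrite /minor /determinant big1// => s _.
(* Pigeonhole: [s] is injective, so it cannot map {i | m <= i} into {i | m < i}.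
   For the resulting [i], the factor [H (f i) (g (s i))] is 0. *)
have [i /andP[mi sim]] : exists i : 'I_k, (m <= i)%N && (s i <= m)%N.
  apply/existsP; apply: contraT; rewrite negb_exists => /forallP sP.
  have sub : s @: [set i : 'I_k | (m <= i)%N]
      \subset [set i : 'I_k | (m < i)%N].
    apply/fintype.subsetP => _ /imsetP[i + ->]; rewrite !inE => mi.
    by have := sP i; rewrite mi/= -ltnNge.
  have := subset_leq_card sub; rewrite card_imset; last exact: perm_inj.
  rewrite leqNgt => /negP[]; apply: proper_card; apply/properP; split.
    by apply/fintype.subsetP => i; rewrite !inE; exact: ltnW.
  by exists m; rewrite !inE ?ltnn.
apply/eqP; rewrite mulf_eq0; apply/orP; right; apply/prodf_eq0; exists i => //.
rewrite mxE H0//; have := increasing_le fI mi; have := increasing_le gI sim.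
by move=> /leq_ltn_trans/(_ gf_m)/leq_trans; apply.
Qed.

(** * Explicit 4x4 matrices and the Jacobi product *)

(** The entries are listed row by row, whereas Jacobi coordinates are listed column by column. *)
Definition ut4 (R : realType) (m12 m13 m14 m23 m24 m34 : R) : 'M[R]_4 :=
  \matrix_(i, j) nth 0 (nth [::] [:: [:: 1; m12; m13; m14]; [:: 0; 1; m23; m24];
                                     [:: 0; 0; 1; m34]; [:: 0; 0; 0; 1]] i) j.

(** Case analysis that yields ring literals, on which the [nth] in [ut4] computes. *)
Lemma ord4P (P : 'I_4 -> Prop) :
  P 0 -> P 1 -> P 2%:R -> P 3%:R -> forall i, P i.
Proof.
move=> P0 P1 P2 P3 [[|[|[|[|//]]]] i4];
  [move: P0|move: P1|move: P2|move: P3]; by congr P; apply: val_inj.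
Qed.

Ltac ord4 i := elim/ord4P: i.

Lemma mul_ut4 (R : realType) (a b c d e f a' b' c' d' e' f' : R) :
  ut4 a b c d e f *m ut4 a' b' c' d' e' f' =
  ut4 (a + a') (b + b' + a * d') (c + c' + a * e' + b * f')
      (d + d') (e + e' + d * f') (f + f').
Proof.
apply/matrixP => i j; rewrite !mxE !big_ord_recl big_ord0 !mxE.
by ord4 i; ord4 j => /=; ring.
Qed.

Lemma Jmx4E (R : realType) (t : R) :
  [/\ Jmx 4 1 t = ut4 t 0 0 0 0 0, Jmx 4 2 t = ut4 0 0 0 t 0 0 &
      Jmx 4 3 t = ut4 0 0 0 0 0 t].
Proof.
by split; rewrite Jmx1; apply/matrixP => i j; rewrite !mxE;
  ord4 i; ord4 j => /=; ring.
Qed.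

(* [a b c d e f] stand for x_12, x_13, x_23, x_14, x_24, x_34. *)
Definition jac4 (R : realType) (a b c d e f : R) : 'M[R]_4 :=
  ut4 (a + c + f) (a * b + (a + c) * e) (a * b * d) (b + e) (b * d) d.

Lemma mul_Jmx4 (R : realType) (a b c d e f : R) :
  Jmx 4 1 a *m Jmx 4 2 b *m Jmx 4 1 c *m Jmx 4 3 d *m Jmx 4 2 e *m Jmx 4 1 f
  = jac4 a b c d e f.
Proof.
have [-> _ _] := Jmx4E a; have [_ -> _] := Jmx4E b; have [-> _ _] := Jmx4E c.
have [_ _ ->] := Jmx4E d; have [_ -> _] := Jmx4E e; have [-> _ _] := Jmx4E f.
by rewrite !mul_ut4; congr ut4; ring.
Qed.

Lemma Jacobi_prod4 (R : realType) (x : coords R) :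
  Jacobi_prod 4 x =
  jac4 (x 1 2)%N (x 1 3)%N (x 2 3)%N (x 1 4)%N (x 2 4)%N (x 3 4)%N.
Proof.
have -> : Jacobi_prod 4 x =
    Jacobi_block 4 x 1 *m (Jacobi_block 4 x 2 *m Jacobi_block 4 x 3).
  rewrite /Jacobi_prod; do 3!(rewrite big_ltn; last by []).
  by rewrite big_geq; [rewrite mulmx1|].
have -> : Jacobi_block 4 x 1 = Jmx 4 1 (x 1 2)%N.
  by rewrite /Jacobi_block big_ltn; [rewrite big_geq; [rewrite mulmx1|]|].
have -> : Jacobi_block 4 x 2 = Jmx 4 2 (x 1 3)%N *m Jmx 4 1 (x 2 3)%N.
  rewrite /Jacobi_block; do 2!(rewrite big_ltn; last by []).
  by rewrite big_geq; [rewrite mulmx1|].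
have -> : Jacobi_block 4 x 3 =
    Jmx 4 3 (x 1 4)%N *m (Jmx 4 2 (x 2 4)%N *m Jmx 4 1 (x 3 4)%N).
  rewrite /Jacobi_block; do 3!(rewrite big_ltn; last by []).
  by rewrite big_geq; [rewrite mulmx1|].
by rewrite -mul_Jmx4 !mulmxA.
Qed.

(** * Total positivity of 4x4 matrices *)

Lemma det2 (F : comPzRingType) (A : 'M[F]_2) :
  \det A = A 0 0 * A 1 1 - A 0 1 * A 1 0.
Proof.
rewrite (expand_det_row _ 0) !big_ord_recl big_ord0 /cofactor !det_mx11 !mxE.
have -> : lift 0 0 = 1 :> 'I_2 by exact: val_inj.
have -> : lift 1 0 = 0 :> 'I_2 by exact: val_inj.
by rewrite /= expr0 expr1; ring.
Qed.

Lemma det3 (F : comPzRingType) (A : 'M[F]_3) :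
  \det A = A 0 0 * (A 1 1 * A 2%:R 2%:R - A 1 2%:R * A 2%:R 1)
         - A 0 1 * (A 1 0 * A 2%:R 2%:R - A 1 2%:R * A 2%:R 0)
         + A 0 2%:R * (A 1 0 * A 2%:R 1 - A 1 1 * A 2%:R 0).
Proof.
rewrite (expand_det_row _ 0) !big_ord_recl big_ord0 /cofactor !det2 !mxE.
have -> : lift 0 0 = 1 :> 'I_3 by exact: val_inj.
have -> : lift 0 0 = 1 :> 'I_2 by exact: val_inj.
have -> : lift 0 1 = 2%:R :> 'I_3 by exact: val_inj.
have -> : lift 1 0 = 0 :> 'I_3 by exact: val_inj.
have -> : lift 1 1 = 2%:R :> 'I_3 by exact: val_inj.
have -> : lift 2%:R 0 = 0 :> 'I_3 by exact: val_inj.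
have -> : lift 2%:R 1 = 1 :> 'I_3 by exact: val_inj.
by rewrite /= expr0 expr1 sqrrN expr1n; ring.
Qed.

Lemma increasing_leq n k (f : 'I_k -> 'I_n) : increasing f -> (k <= n)%N.
Proof.
move=> fI; rewrite -[k]card_ord -[n]card_ord; apply: (@leq_card _ _ f) => i j.
by case: (ltngtP i j) => [/fI|/fI|/val_inj//] + fij; rewrite fij ltnn.
Qed.

Lemma increasing_id4 (f : 'I_4 -> 'I_4) : increasing f -> f =1 id.
Proof.
move=> fI i; have f01 := fI 0 1 erefl; have f12 := fI 1 2%:R erefl.
have f23 := fI 2%:R 3%:R erefl; have f3 := ltn_ord (f 3%:R).
by apply: val_inj => /=; ord4 i; move: f01 f12 f23 f3 => /=; lia.
Qed.

Lemma det_ut4 (R : realType) (a b c d e f : R) : \det (ut4 a b c d e f) = 1.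
Proof.
rewrite -det_tr det_trig.
  by rewrite big1// => i _; rewrite !mxE; ord4 i.
by apply/is_trig_mxP => i j; rewrite !mxE; ord4 i; ord4 j.
Qed.

Lemma unip_ut4 (R : realType) (a b c d e f : R) : unip (ut4 a b c d e f).
Proof.
split; last by move=> i; rewrite mxE; ord4 i.
split; last by rewrite unitmxE det_ut4 unitr1.
by move=> i j; rewrite mxE; ord4 i; ord4 j.
Qed.

(** By [minor_neq0_le] only minors with $f(i) \le g(i)$ for all $i$ matter. Each of them is 1, one
    of the twelve quantities assumed positive, or [m12 * m34]. *)
Lemma unip_tp_ut4 (R : realType) (m12 m13 m14 m23 m24 m34 : R) :
  0 < m12 -> 0 < m13 -> 0 < m14 -> 0 < m23 -> 0 < m24 -> 0 < m34 ->
  0 < m12 * m23 - m13 -> 0 < m12 * m24 - m14 -> 0 < m13 * m24 - m14 * m23 ->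
  0 < m13 * m34 - m14 -> 0 < m23 * m34 - m24 ->
  0 < m12 * (m23 * m34 - m24) - (m13 * m34 - m14) ->
  unip_tp (ut4 m12 m13 m14 m23 m24 m34).
Proof.
move=> p12 p13 p14 p23 p24 p34 q23 q24 q34 r34 s34 t.
split; first exact: unip_ut4.
(* The minor with rows 1, 3 and columns 2, 4, supplied here because [lra] treats this product as an
   atom. *)
have p1234 : 0 < m12 * m34 by exact: mulr_gt0.
move=> k f g fI gI [H Hu HN0]; have := minor_neq0_le Hu fI gI HN0.
have kn := increasing_leq fI; clear H Hu HN0; rewrite /minor.
case: k f g fI gI kn => [|[|[|[|[|//]]]]] f g fI gI _ le_fg.
- by rewrite det_mx00.
- rewrite det_mx11 !mxE; move: (f 0) (g 0) (le_fg 0) => i j.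
  by ord4 i; ord4 j.
- rewrite det2 !mxE.
  move: (f 0) (f 1) (fI 0 1 erefl) (g 0) (g 1) (gI 0 1 erefl)
    (le_fg 0) (le_fg 1) => i0 i1 + j0 j1.
  by ord4 i0; ord4 i1 => //= _; ord4 j0; ord4 j1 => //= _ _ _; lra.
- rewrite det3 !mxE.
  move: (f 0) (f 1) (f 2%:R) (g 0) (g 1) (g 2%:R)
    (fI 0 1 erefl) (fI 1 2%:R erefl) (gI 0 1 erefl) (gI 1 2%:R erefl)
    (le_fg 0) (le_fg 1) (le_fg 2%:R) => i0 i1 i2 j0 j1 j2.
  ord4 i0; ord4 i1 => //; ord4 i2 => // _ _;
  ord4 j0; ord4 j1 => //; ord4 j2 => //= _ _ _ _ _;
    lra.
- have -> : mxsub f g (ut4 m12 m13 m14 m23 m24 m34) =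
      ut4 m12 m13 m14 m23 m24 m34.
    by apply/matrixP => i j; rewrite mxE !increasing_id4.
  by rewrite det_ut4.
Qed.

Lemma unip_tp_jac4 (R : realType) (a b c d e f : R) :
  0 < a -> 0 < b -> 0 < c -> 0 < d -> 0 < e -> 0 < f ->
  unip_tp (jac4 a b c d e f).
Proof.
move=> a0 b0 c0 d0 e0 f0.
have pos := (addr_gt0, mulr_gt0, a0, b0, c0, d0, e0, f0).
apply: unip_tp_ut4.
1-6: by rewrite ?pos.
- by rewrite (_ : _ - _ = c * b + f * (b + e)) ?pos//; ring.
- by rewrite (_ : _ - _ = (c + f) * (b * d)) ?pos//; ring.
- by rewrite (_ : _ - _ = c * e * (b * d)) ?pos//; ring.
- by rewrite (_ : _ - _ = (a + c) * (e * d)) ?pos//; ring.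
- by rewrite (_ : _ - _ = e * d) ?pos//; ring.
- by rewrite (_ : _ - _ = f * e * d) ?pos//; ring.
Qed.

(** * Uniqueness of Jacobi coordinates and the map [bar] *)

Lemma ut4_inj (R : realType) (a b c d e f a' b' c' d' e' f' : R) :
  ut4 a b c d e f = ut4 a' b' c' d' e' f' ->
  [/\ a = a', b = b', c = c' & [/\ d = d', e = e' & f = f']].
Proof.
move=> /matrixP E.
have := (E 0 1, E 0 2%:R, E 0 3%:R, E 1 2%:R, E 1 3%:R, E 2%:R 3%:R).
by rewrite !mxE /= => -[[[[[]]]]].
Qed.

(** The coordinates are recovered in the order $d, b, a, e, c, f$ from the entries (3,4), (2,4),
    (1,4), (2,3), (1,3), (1,2); the divisions are by $b$, $d$ and $e$. *)
Lemma jac4_inj (R : realType) (a b c d e f a' b' c' d' e' f' : R) :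
  0 < b -> 0 < d -> 0 < e ->
  jac4 a b c d e f = jac4 a' b' c' d' e' f' ->
  [/\ a = a', b = b', c = c' & [/\ d = d', e = e' & f = f']].
Proof.
move=> /lt0r_neq0 b0 /lt0r_neq0 d0 /lt0r_neq0 e0.
move=> /ut4_inj[E12 E13 E14 [E23 E24 dd]].
move: E24 E14 d0; rewrite dd => E24 E14 d0.
have bb : b = b' by exact: (mulIf d0).
have aa : a = a' by apply: (mulIf b0); apply: (mulIf d0); rewrite {2}bb.
have ee : e = e' by move: E23; rewrite bb => /addrI.
have cc : c = c'.
  by move: E13; rewrite aa bb ee => /addrI/mulIf; rewrite -ee => /(_ e0)/addrI.
by do 2![split=> //]; move: E12; rewrite aa cc => /addrI.
Qed.

Lemma bar_jac4 (R : realType) (a b c d e f : R) :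
  0 < a -> 0 < b -> 0 < c -> 0 < d -> 0 < e -> 0 < f ->
  bar (jac4 a b c d e f) = jac4 a^-1 b^-1 c^-1 d^-1 e^-1 f^-1.
Proof.
move=> a0 b0 c0 d0 e0 f0; rewrite /bar Jacobi_prod4 /Jacobi_coords.
set S := [set y | _]%classic.
(* An explicit coordinate function shows that [S] is inhabited, so [xget] returns a member of [S]
   and not its default; [jac4_inj] then gives the values of that member. *)
have Sx : S (fun i j =>
    nth 0 (nth [::] [:: [:: a; b; d]; [:: c; e]; [:: f]] i.-1) (j - i).-1).
  split; last by rewrite Jacobi_prod4.
  by move=> [|[|[|[|i]]]] [|[|[|[|[|j]]]]].
have [_] : S (xget (fun _ _ => 0) S).
  by apply: xgetPex; exact: (ex_intro _ _ Sx).
rewrite Jacobi_prod4 => /jac4_inj.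
by move=> /(_ b0 d0 e0)[<- <- <- [<- <- <-]].
Qed.

(** * The reversal matrix $P$ and uniqueness of the twist *)

Section Revmx.
Variables (R : realType) (n : nat).

Lemma mul_revmx (A : 'M[R]_n) i j : (revmx R n *m A) i j = A (rev_ord i) j.
Proof.
rewrite mxE (bigD1 (rev_ord i))//= big1 ?addr0 => [|l /negPf li].
  by rewrite mxE (_ : _ == _) ?mul1r//=; have := ltn_ord i; lia.
rewrite mxE (_ : (_ == _) = false) ?mul0r//.
by move: li (ltn_ord i) (ltn_ord l); rewrite -val_eqE /=; lia.
Qed.

Lemma mulmx_rev (A : 'M[R]_n) i j : (A *m revmx R n) i j = A i (rev_ord j).
Proof.
have revT : (revmx R n)^T = revmx R n.
  by apply/matrixP => k l; rewrite !mxE addnC.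
have -> : A *m revmx R n = (revmx R n *m A^T)^T by rewrite trmx_mul trmxK revT.
by rewrite mxE mul_revmx mxE.
Qed.

Lemma revmxK : revmx R n *m revmx R n = 1%:M.
Proof.
apply/matrixP => i j; rewrite mul_revmx !mxE -val_eqE /=.
by congr (nat_of_bool _)%:R; have := ltn_ord i; lia.
Qed.

(** One solution with invertible diagonal part identifies the triple chosen by [xget]: multiplying
    the relation by $P$ on the left gives $MP = (P M_1 P) D M_2$, where $P M_1 P$ is lower
    unitriangular. *)
Lemma twist_uniq (M M1 M2 : 'M[R]_n) (d : 'rV[R]_n) :
  (forall i, d 0 i != 0) -> twist_rel M (M1, diag_mx d, M2) ->
  mprime M = M1 /\ msecond M = M2.
Proof.
move=> d0 Md.
have : twist_rel M (twist_triple M).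
  by apply: (xgetPex (0, 0, 0)); exists (M1, diag_mx d, M2).
rewrite /mprime /msecond.
case: (twist_triple M) => -[N1 D] N2 /= [N1u N2u /is_diag_mxP Dd].
case: Md => M1u M2u _ ->.
have rev_tr (A : 'M[R]_n) : unip_tp A ->
    lower_unitri (revmx R n *m A *m revmx R n).
  move=> [[[A0 _] A1] _].
  split=> [i j ij|i]; rewrite mulmx_rev mul_revmx ?A1// A0//=.
  by have := ltn_ord j; lia.
have up (A : 'M[R]_n) : unip_tp A -> lower_unitri A^T.
  by move=> [[[A0 _] A1] _]; split=> [i j|i]; rewrite mxE ?A1//; apply: A0.
have [dD ->] : exists dD, D = diag_mx dD.
  exists (\row_i D i i); apply/matrixP => i j; rewrite !mxE.
  by case: eqVneq => [->|/Dd]; rewrite ?mulr1n// mulr0n.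
move=> /(congr1 (mulmx (revmx R n))); rewrite !mulmxA => E.
have [E1 ->] :=
  LDU_uniq (rev_tr _ M1u) (rev_tr _ N1u) (up _ M2u) (up _ N2u) d0 E.
split=> //.
have revMK A :
    revmx R n *m (revmx R n *m A *m revmx R n) *m revmx R n = A.
  by rewrite !mulmxA revmxK mul1mx -mulmxA revmxK mulmx1.
by rewrite -(revMK M1) E1 revMK.
Qed.

End Revmx.

(** * The explicit twist and the substitutions *)

Lemma twist_jac4 (R : realType) (a b c d e f : R) :
  0 < a -> 0 < b -> 0 < c -> 0 < d -> 0 < e -> 0 < f ->
  mprime (jac4 a^-1 b^-1 c^-1 d^-1 e^-1 f^-1) =
    jac4 d b (d * e / b) a (b * c / a) (d * e * f / (b * c)) /\
  msecond (jac4 a^-1 b^-1 c^-1 d^-1 e^-1 f^-1) =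
    jac4 (a * b * d / (c * e)) (c * e / f) (b * d / e) f e d.
Proof.
move=> a0 b0 c0 d0 e0 f0.
have pos := (divr_gt0, mulr_gt0, a0, b0, c0, d0, e0, f0).
have [[an bn] cn] := (lt0r_neq0 a0, lt0r_neq0 b0, lt0r_neq0 c0).
have [[dn en] fn] := (lt0r_neq0 d0, lt0r_neq0 e0, lt0r_neq0 f0).
(* The pivots of $\bar M P$: quotients of its successive leading principal minors $1/(abd)$,
   $-1/(bcde)$, $-1/(def)$, $1$. *)
apply: (@twist_uniq _ _ _ _ _ (\row_(i < 4)
   nth 0 [:: (a * b * d)^-1; - a / (c * e); b * c / f; - (d * e * f)] i)).
  move=> i; rewrite mxE; ord4 i => /=;
  by rewrite ?mulf_neq0 ?invr_eq0 ?oppr_eq0 ?mulf_neq0.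
split.
- by apply: unip_tp_jac4; rewrite ?pos.
- by apply: unip_tp_jac4; rewrite ?pos.
- exact: diag_mx_is_diag.
rewrite mul_mx_diag; apply/matrixP => i j.
rewrite mulmx_rev mul_revmx [RHS]mxE.
under [RHS]eq_bigr do rewrite mxE mulmx_rev.
rewrite !big_ord_recl big_ord0 !mxE.
by ord4 i; ord4 j => /=; field; rewrite ?an ?bn ?cn ?dn ?en ?fn.
Qed.

Theorem proposition4 (R : realType) (M : coords R -> 'M[R]_4)
    (hM : M = fun x : coords R =>
       Jmx 4 1 (x 1 2)%N *m Jmx 4 2 (x 1 3)%N *m Jmx 4 1 (x 2 3)%N
       *m Jmx 4 3 (x 1 4)%N *m Jmx 4 2 (x 2 4)%N *m Jmx 4 1 (x 3 4)%N)
    (x : coords R) (hx : pos_coords 4 x) :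
  [/\ Lsub 1 2 3 (Lsub 1 2 4 (Lsub 1 3 4 (Lsub 2 3 4 M))) x
      = Lsub 2 3 4 (Lsub 1 3 4 (Lsub 1 2 4 (Lsub 1 2 3 M))) x,
      Lsub 2 3 4 (Lsub 1 3 4 (Lsub 1 2 4 (Lsub 1 2 3 M))) x
      = mprime (bar (M x)),
      Rsub 1 2 3 (Rsub 1 2 4 (Rsub 1 3 4 (Rsub 2 3 4 M))) x
      = Rsub 2 3 4 (Rsub 1 3 4 (Rsub 1 2 4 (Rsub 1 2 3 M))) x &
      Rsub 2 3 4 (Rsub 1 3 4 (Rsub 1 2 4 (Rsub 1 2 3 M))) x
      = msecond (bar (M x))].
Proof.
pose a := (x 1 2)%N; pose b := (x 1 3)%N; pose c := (x 2 3)%N.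
pose d := (x 1 4)%N; pose e := (x 2 4)%N; pose f := (x 3 4)%N.
have [a0 b0 c0] : [/\ 0 < a, 0 < b & 0 < c] by split; exact: hx.
have [d0 e0 f0] : [/\ 0 < d, 0 < e & 0 < f] by split; exact: hx.
have [[an bn] cn] := (lt0r_neq0 a0, lt0r_neq0 b0, lt0r_neq0 c0).
have [[dn en] fn] := (lt0r_neq0 d0, lt0r_neq0 e0, lt0r_neq0 f0).
have ME y :
    M y = jac4 (y 1 2)%N (y 1 3)%N (y 2 3)%N (y 1 4)%N (y 2 4)%N (y 3 4)%N.
  by rewrite hM mul_Jmx4.
rewrite [M x]ME (bar_jac4 a0 b0 c0 d0 e0 f0).
have [-> ->] := twist_jac4 a0 b0 c0 d0 e0 f0.
(* Substitutions act by precomposition, so the outermost one is applied to [x] first. Each side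
   becomes a [jac4], and the arguments are compared as rational functions. *)
rewrite /Lsub /Rsub !ME /upd3 /= -/a -/b -/c -/d -/e -/f.
by split; congr jac4; field; rewrite ?an ?bn ?cn ?dn ?en ?fn.
Qed.
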